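(* If $n=4t+2\ge10$, then $\zeta(G_n)=n(n+2)$.
   Context: $G_n=C_n\square P_2$ is the prism graph with vertex set $\{(t,i),(b,i): i\in\mathbb{Z}_n\}$, with $(t,i)$ adjacent to $(t,i\pm1)$ and $(b,i)$, and $(b,i)$ adjacent to $(b,i\pm1)$ and $(t,i)$. $\zeta(G)$ denotes the number of dominating sets of $G$ of minimum size $\gamma(G)$, counting distinct vertex subsets of the labeled graph separately. *)

(* Defs.v *)
From mathcomp Require Import all_boot all_order all_algebra.

Set Implicit Arguments.
Unset Strict Implicit.
Unset Printing Implicit Defensive.

Import GRing.Theory.

Section Domination.

(* A graph is given by its adjacency relation e on a finite vertex type. *)
Variables (T : finType) (e : rel T).

Definition dominating (D : {set T}) : bool :=
  [forall v, (v \in D) || [exists u in D, e u v]].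

(* The full vertex set is dominating, so it is a legitimate seed for arg min. *)
Definition domination_number : nat :=
  #|[arg min_(D < [set: T] | dominating D) #|D|]|.

Definition zeta : nat :=
  #|[set D : {set T} | dominating D & #|D| == domination_number]|.

Lemma dominating_setT : dominating [set: T].
Proof. by apply/forallP => v; rewrite in_setT. Qed.

Lemma domination_number_le (D : {set T}) :
  dominating D -> domination_number <= #|D|.
Proof.
by rewrite /domination_number; case: arg_minnP => [|A _ minA /minA //];
  exact: dominating_setT.
Qed.

Lemma domination_number_ex :
  exists2 D : {set T}, dominating D & #|D| = domination_number.
Proof.
rewrite /domination_number; case: arg_minnP => [|A dA _]; last by exists A.
exact: dominating_setT.
Qed.

End Domination.

(* The vertices (t,i) and (b,i) are (true,i) and (false,i). The type 'Z_n is
   the ring of integers modulo n only when n > 1, and the graph is the simple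
   graph C_n [] P_2 when n >= 3. *)
Definition prism_vertex (n : nat) : finType := (bool * 'Z_n)%type.

Definition prism (n : nat) : rel (prism_vertex n) :=
  fun u v =>
    (u.1 == v.1) && ((v.2 == u.2 + 1)%R || (v.2 == u.2 - 1)%R)
    || (u.1 != v.1) && (u.2 == v.2).

Lemma prism_sym (n : nat) : symmetric (@prism n).
Proof.
move=> [a i] [b j]; rewrite /prism /= ![b == a]eq_sym ![j == i]eq_sym.
congr (_ && _ || _); rewrite orbC.
by congr (_ || _); [rewrite eq_sym subr_eq | rewrite [RHS]eq_sym subr_eq].
Qed.

Lemma prism_irr (n : nat) : irreflexive (@prism n).
Proof.
move=> [a i]; rewrite /prism /= !eqxx /= orbF.
have shift_eq (c : 'Z_n) : (i == i + c)%R = (c == 0)%R.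
  by rewrite -[X in (X == _)%R]addr0 (inj_eq (addrI i)) eq_sym.
by rewrite !shift_eq oppr_eq0 oner_eq0.
Qed.

(* Main.v *)
(* A set D of vertices of the prism is a cyclic word of n columns, and it is
   dominating iff every three consecutive columns cover the middle one. Since
   each vertex covers four vertices, 4 |D| - 2n is the total excess, that is the
   sum over the vertices of the number of times they are covered, minus one.
   For n = 4t + 2 the excess is 0 mod 4, so it suffices to show that no cyclic
   word has excess 0 and that n (n + 2) of them have excess 4. Counting closed
   walks of given excess is a transfer-matrix computation. The walks of excess 0
   have period 4, so the fourth power of the transfer operator is unipotent on
   the part that survives a few steps, and the counts are polynomials in t given
   by Newton's forward difference formula with three terms. *)

Require Import Defs.
From mathcomp Require Import all_boot all_order all_algebra.
From mathcomp Require Import zify.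

Set Implicit Arguments.
Unset Strict Implicit.
Unset Printing Implicit Defensive.

(** * Columns, coverage and excess of open walks *)

Notation column := (bool * bool)%type.

Definition weight (c : column) : nat := c.1 + c.2.

Definition covered (a b c : column) : bool :=
  [|| b.1, b.2, a.1 | c.1] && [|| b.1, b.2, a.2 | c.2].

(** Counts how often the two vertices of the column [b] are covered beyond once each; the truncated
    subtraction is exact when [covered a b c] holds. *)
Definition excess (a b c : column) : nat :=
  weight a + 2 * weight b + weight c - 2.

Fixpoint covered_walk (a b : column) (w : seq column) : bool :=
  if w is c :: w' then covered a b c && covered_walk b c w' else true.

Fixpoint walk_excess (a b : column) (w : seq column) : nat :=
  if w is c :: w' then excess a b c + walk_excess b c w' else 0.

Lemma covered_walkP (d a b : column) (w : seq column) :
  reflect (forall i, i < size w ->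
             covered (nth d [:: a, b & w] i) (nth d [:: a, b & w] i.+1)
                     (nth d [:: a, b & w] i.+2))
          (covered_walk a b w).
Proof.
elim: w a b => [|c w IHw] a b /=; first by left.
apply: (iffP andP) => [[cov_abc /IHw cov_w] [//|i] /cov_w //|cov_w].
by split; [exact: (cov_w 0) | apply/IHw => i; exact: (cov_w i.+1)].
Qed.

Lemma excess_weight (a b c : column) :
  covered a b c -> excess a b c + 2 = weight a + 2 * weight b + weight c.
Proof. by case: a b c => [[] []] [[] []] [[] []]. Qed.

(* Every chosen vertex covers four vertices, itself included; the terms in
   [a], [b], [p] and [q] are the boundary contributions of an open walk. *)
Lemma walk_excess_weight (a b p q : column) (w : seq column) :
  covered_walk a b (w ++ [:: p; q]) ->
  walk_excess a b (w ++ [:: p; q]) + 2 * (size w).+2 + weight p + 3 * weight q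
  = 4 * (sumn (map weight w) + weight p + weight q) + weight a + 3 * weight b.
Proof.
elim: w a b => [|c w IHw] a b /=.
  by case/and3P=> /excess_weight e1 /excess_weight e2 _; lia.
by case/andP=> /excess_weight e1 /IHw; lia.
Qed.

(** * Enumeration of words over the columns *)

Definition columns : seq column :=
  [:: (false, false); (false, true); (true, false); (true, true)].

Lemma mem_columns (c : column) : c \in columns.
Proof. by case: c => [[] []]. Qed.

Fixpoint words (k : nat) : seq (seq column) :=
  if k is k'.+1 then [seq c :: w | c <- columns, w <- words k'] else [:: [::]].

Lemma wordsS (k : nat) :
  words k.+1 = [seq c :: w | c <- columns, w <- words k].
Proof. by []. Qed.

Lemma mem_words (k : nat) (w : seq column) : (w \in words k) = (size w == k).
Proof.
elim: k w => [|k IHk] w; first by case: w.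
rewrite wordsS; apply/allpairsP/idP => [[[c w'] /= [_ w'k ->]]|].
  by rewrite /= eqSS -IHk.
case: w => //= c w; rewrite eqSS -IHk => wk.
by exists (c, w); rewrite mem_columns.
Qed.

Lemma words_uniq (k : nat) : uniq (words k).
Proof.
elim: k => // k IHk; rewrite wordsS; apply: allpairs_uniq => //.
by move=> [c w] [c' w'] _ _ [-> ->].
Qed.

(** * Counting walks by the transfer operator *)

Lemma count_words_rec (P : pred (seq column)) (k : nat) :
  count P (words k.+1)
  = sumn [seq count (fun w => P (c :: w)) (words k) | c <- columns].
Proof. by rewrite /= !count_cat !count_map. Qed.

(* A state [(a, b, m)] stands for a walk whose last two columns are [a] and [b]
   and which may still spend an excess of exactly [m]. *)
Notation state := (column * column * nat)%type.

Definition successors (s : state) : seq state :=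
  let: (a, b, m) := s in
  [seq (b, c, m - excess a b c) |
     c <- columns & covered a b c && (excess a b c <= m)].

Definition transfer (f : state -> nat) (s : state) : nat :=
  sumn [seq f s' | s' <- successors s].

Definition closing (p q : column) (s : state) : nat :=
  let: (a, b, m) := s in
  covered_walk a b [:: p; q] && (walk_excess a b [:: p; q] == m).

(** Peeling off the first free column spends its excess; a choice that overspends [m] admits no
    completion, which is why [successors] may drop it. *)
Lemma count_walks (k : nat) (p q a b : column) (m : nat) :
  count (fun w => covered_walk a b (w ++ [:: p; q])
                  && (walk_excess a b (w ++ [:: p; q]) == m)) (words k)
  = iter k transfer (closing p q) (a, b, m).
Proof.
elim: k a b m => [|k IHk] a b m; first by rewrite /= addn0.
rewrite count_words_rec iterS.
move: (iter k _ _) IHk => f IHk; rewrite /transfer /successors -map_comp.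
elim: columns => //= c cs ->.
case: (boolP (covered a b c)) => _ /=; last first.
  by rewrite (@eq_count _ _ pred0) ?count_pred0.
case: (leqP (excess a b c) m) => [le_em|lt_me] /=.
  rewrite -IHk; congr (_ + _); apply: eq_count => w /=; congr (_ && _).
  by apply/eqP/eqP; lia.
rewrite (@eq_count _ _ pred0) ?count_pred0 // => w /=.
by apply/negbTE; rewrite negb_and orbC; apply/orP; left; apply/eqP; lia.
Qed.

(** * Restriction to finitely many states *)

Definition states : seq state :=
  [seq (ab, m) | ab <- [seq (a, b) | a <- columns, b <- columns],
                 m <- iota 0 5].

(* Tables share the values of an iterate of [transfer], which would otherwise
   be recomputed exponentially often. *)
Definition tabulate (f : state -> nat) : seq nat := map f states.

Definition lookup (l : seq nat) (s : state) : nat := nth 0 l (index s states).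

Lemma lookup_tabulate (f : state -> nat) :
  {in states, lookup (tabulate f) =1 f}.
Proof.
by move=> s ss; rewrite /lookup (nth_map s) ?index_mem // nth_index.
Qed.

(** Budgets never increase along [successors], so those up to 4, the largest excess needed, form a
    closed set. *)
Lemma successors_states (s s' : state) :
  s \in states -> s' \in successors s -> s' \in states.
Proof.
have /allP closed : all (fun s => all [in states] (successors s)) states.
  by vm_compute.
by move=> /closed/allP; apply.
Qed.

Lemma eq_transfer (f g : state -> nat) :
  {in states, f =1 g} -> {in states, transfer f =1 transfer g}.
Proof.
move=> eq_fg s ss; congr sumn; apply/eq_in_map => s' s's.
exact/eq_fg/(successors_states ss s's).
Qed.

Lemma eq_iter_transfer (k : nat) (f g : state -> nat) :
  {in states, f =1 g} -> {in states, iter k transfer f =1 iter k transfer g}.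
Proof. by move=> eq_fg; elim: k => //= k IHk; apply: eq_transfer. Qed.

(** * Linearity and Newton's formula *)

Lemma sumn_lin (T : Type) (r : seq T) (x y : nat) (f g h : T -> nat) :
  sumn [seq f i + x * g i + y * h i | i <- r]
  = sumn (map f r) + x * sumn (map g r) + y * sumn (map h r).
Proof. by elim: r => [|i r /= ->] /=; lia. Qed.

Lemma transfer_lin (x y : nat) (f g h : state -> nat) :
  transfer (fun s => f s + x * g s + y * h s)
  =1 (fun s => transfer f s + x * transfer g s + y * transfer h s).
Proof. by move=> s; exact: sumn_lin. Qed.

Lemma iter_transfer_lin (k x y : nat) (f g h : state -> nat) :
  {in states, iter k transfer (fun s => f s + x * g s + y * h s)
     =1 (fun s => iter k transfer f s + x * iter k transfer g s
                  + y * iter k transfer h s)}.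
Proof.
elim: k => // k IHk s ss.
by rewrite iterS (eq_transfer IHk) // transfer_lin.
Qed.

(* Newton's forward difference formula for the operator [transfer ^ 4]. *)
Lemma iter_transfer_newton (f g h : state -> nat) :
  {in states, iter 4 transfer f =1 (fun s => f s + g s)} ->
  {in states, iter 4 transfer g =1 (fun s => g s + h s)} ->
  {in states, iter 4 transfer h =1 h} ->
  forall u, {in states, iter (4 * u) transfer f
                 =1 (fun s => f s + u * g s + 'C(u, 2) * h s)}.
Proof.
move=> Af Ag Ah; elim=> [|u IHu] s ss.
  by rewrite muln0 bin0n /= mul0n !addn0.
rewrite mulnS iterD (eq_iter_transfer _ IHu) // iter_transfer_lin //.
(* The coefficient of [h] grows by [u], which is Pascal's rule for ['C(u.+1, 2)]. *)
by rewrite Af // Ag // Ah // binS bin1; lia.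
Qed.

(** * Computed Newton coefficients *)

Definition tabulated_iter (k : nat) (l : seq nat) : seq nat :=
  iter k (fun l => tabulate (transfer (lookup l))) l.

Lemma lookup_tabulated_iter (k : nat) (l : seq nat) (f : state -> nat) :
  {in states, lookup l =1 f} ->
  {in states, lookup (tabulated_iter k l) =1 iter k transfer f}.
Proof.
move=> lf; elim: k => // k IHk s ss.
by rewrite /tabulated_iter iterS lookup_tabulate // (eq_transfer IHk).
Qed.

Definition difference (l : seq nat) : seq nat :=
  let l' := tabulated_iter 4 l in
  tabulate (fun s => lookup l' s - lookup l s).

(* Only after eight steps are the differences nonnegative, so that the truncated
   subtraction in [difference] is exact, and eventually zero. *)
Definition newton0 (p q : column) := tabulated_iter 8 (tabulate (closing p q)).
Definition newton1 (p q : column) := difference (newton0 p q).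
Definition newton2 (p q : column) := difference (newton1 p q).

Definition increment (l d : seq nat) : bool :=
  let l' := tabulated_iter 4 l in
  all (fun s => lookup l' s == lookup l s + lookup d s) states.

(** Certifies the hypotheses of [iter_transfer_newton]. The empty table reads as 0 everywhere, so
    the last test says that four transfer steps fix [l2]. *)
Definition newton_check (p q : column) : bool :=
  let l0 := newton0 p q in
  let l1 := difference l0 in
  let l2 := difference l1 in
  [&& increment l0 l1, increment l1 l2 & increment l2 [::]].

Lemma newton_checked :
  all (fun p => all (newton_check p) columns) columns.
Proof. by vm_compute. Qed.

(** * Counts of closed walks *)

Definition closed_total (l : column -> column -> seq nat) (m : nat) : nat :=
  sumn [seq sumn [seq lookup (l p q) (p, q, m) | q <- columns] | p <- columns].

Lemma newton_totals0 :
  [/\ closed_total newton0 0 = 0, closed_total newton1 0 = 0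
    & closed_total newton2 0 = 0].
Proof. by split; vm_compute. Qed.

(** The value at [n = 10] and the first two forward differences, in steps of 4, of [n * (n + 2)]. *)
Lemma newton_totals4 :
  [/\ closed_total newton0 4 = 120, closed_total newton1 4 = 104
    & closed_total newton2 4 = 32].
Proof. by split; vm_compute. Qed.

(** Repeating the first two columns at the end makes every cyclic triple occur exactly once. *)
Definition closed_walk (m : nat) (w : seq column) : bool :=
  if w is [:: a, b & w'] then
    covered_walk a b (w' ++ [:: a; b])
    && (walk_excess a b (w' ++ [:: a; b]) == m)
  else false.

Lemma count_closed_walks (k m : nat) :
  count (closed_walk m) (words k.+2)
  = sumn [seq sumn [seq iter k transfer (closing a b) (a, b, m)
                      | b <- columns] | a <- columns].
Proof.
rewrite count_words_rec; congr sumn; apply: eq_map => a.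
rewrite count_words_rec; congr sumn; apply: eq_map => b.
exact: count_walks.
Qed.

Lemma iter_transfer_closing (u : nat) (p q : column) :
  {in states, iter (4 * u.+2) transfer (closing p q)
     =1 (fun s => lookup (newton0 p q) s + u * lookup (newton1 p q) s
                  + 'C(u, 2) * lookup (newton2 p q) s)}.
Proof.
have /allP/(_ p (mem_columns p))/allP/(_ q (mem_columns q)) := newton_checked.
case/and3P=> /allP inc0 /allP inc1 /allP inc2.
have iter_lookup k l : {in states, iter k transfer (lookup l)
                          =1 lookup (tabulated_iter k l)}.
  by move=> s ss; rewrite (lookup_tabulated_iter k (f := lookup l)).
have closing8 : {in states, iter 8 transfer (closing p q)
                   =1 lookup (newton0 p q)}.
  by move=> s ss; rewrite -(lookup_tabulated_iter 8 (lookup_tabulate _)).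
(* Of the [4 * u + 8] steps, the innermost eight produce [newton0]. *)
rewrite -[u.+2]addn2 mulnDr => s ss; rewrite iterD.
rewrite (eq_iter_transfer _ closing8) //.
apply: iter_transfer_newton ss => s' ss'; rewrite iter_lookup //.
- exact/eqP/inc0.
- exact/eqP/inc1.
- by rewrite (eqP (inc2 _ ss')) /lookup nth_nil addn0.
Qed.

Lemma count_closed_walks_newton (u m : nat) : m < 5 ->
  count (closed_walk m) (words (4 * u.+2).+2)
  = closed_total newton0 m + u * closed_total newton1 m
    + 'C(u, 2) * closed_total newton2 m.
Proof.
move=> lt_m5; have ps p q : (p, q, m) \in states.
  rewrite allpairs_f ?mem_iota //.
  by rewrite allpairs_f ?mem_columns.
rewrite count_closed_walks /closed_total -sumn_lin; congr sumn.
apply: eq_map => p; rewrite -sumn_lin; congr sumn.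
by apply: eq_map => q; exact/iter_transfer_closing/ps.
Qed.

Lemma count_closed_walks0 (u : nat) :
  count (closed_walk 0) (words (4 * u.+2).+2) = 0.
Proof.
rewrite (@count_closed_walks_newton u 0 isT).
by have [-> -> ->] := newton_totals0; rewrite !muln0.
Qed.

Lemma count_closed_walks4 (u : nat) :
  count (closed_walk 4) (words (4 * u.+2).+2) = 120 + u * 104 + 'C(u, 2) * 32.
Proof.
rewrite (@count_closed_walks_newton u 4 isT).
by have [-> -> ->] := newton_totals4.
Qed.

(** * Dominating sets of the prism as closed walks *)

Local Open Scope ring_scope.

Definition column_of (n : nat) (D : {set prism_vertex n}) (i : 'Z_n) : column :=
  ((true, i) \in D, (false, i) \in D).

Lemma dominated_vertex (n : nat) (D : {set prism_vertex n}) (b : bool)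
    (i : 'Z_n) :
  ((b, i) \in D) || [exists u in D, prism u (b, i)]
  = [|| (b, i) \in D, (~~ b, i) \in D, (b, i - 1) \in D | (b, i + 1) \in D].
Proof.
congr (_ || _); apply/existsP/or3P => [[[c j] /= /andP[uD]]|].
  rewrite /prism /=.
  case/orP=> [/andP[/eqP eq_cb /orP[]/eqP eq_ij]|/andP[c'b /eqP eq_ij]].
  - by constructor 2; rewrite eq_ij GRing.addrK -eq_cb.
  - by constructor 3; rewrite eq_ij GRing.subrK -eq_cb.
  - by constructor 1; rewrite -eq_ij; case: b c c'b uD => [] [].
case=> uD; [exists (~~ b, i) | exists (b, i - 1) | exists (b, i + 1)];
  rewrite uD /prism /= ?eqxx ?GRing.subrK ?GRing.addrK ?eqxx ?orbT //.
by case: b {uD}.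
Qed.

Lemma dominating_columns (n : nat) (D : {set prism_vertex n}) :
  dominating (@prism n) D
  = [forall i : 'Z_n,
       covered (column_of D (i - 1)) (column_of D i) (column_of D (i + 1))].
Proof.
apply/forallP/forallP => [domD i|covD [b i]].
  have := domD (true, i); have := domD (false, i).
  rewrite !dominated_vertex /covered /column_of /= => covf covt.
  by rewrite covt orbCA covf.
rewrite dominated_vertex; have := covD i; rewrite /covered /column_of /=.
by case: b => /andP[covt covf] //=; rewrite orbCA.
Qed.

Local Close Scope ring_scope.

Definition encode (n : nat) (D : {set prism_vertex n}) : seq column :=
  mkseq (fun i => column_of D i%:R%R) n.

Lemma size_encode (n : nat) (D : {set prism_vertex n}) : size (encode D) = n.
Proof. exact: size_mkseq. Qed.

Section Encoding.

Variable n : nat.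
Hypothesis n_gt1 : 1 < n.

Lemma nth_encode (D : {set prism_vertex n}) (d : column) (i : 'Z_n) :
  nth d (encode D) i = column_of D i.
Proof.
rewrite nth_mkseq ?natr_Zp //.
by rewrite -[X in _ < X](Zp_cast n_gt1).
Qed.

Lemma encode_inj : injective (@encode n).
Proof.
move=> D E eqDE; apply/setP => -[b i].
have [] : column_of D i = column_of E i.
  by rewrite -!(nth_encode _ (false, false)) eqDE.
by case: b.
Qed.

Lemma encode_surj (w : seq column) :
  size w = n -> exists D : {set prism_vertex n}, encode D = w.
Proof.
move=> szw; pose d : column := (false, false).
exists [set v : prism_vertex n |
          if v.1 then (nth d w v.2).1 else (nth d w v.2).2].
apply: (@eq_from_nth _ d); rewrite size_encode // => i lt_in.
rewrite nth_mkseq // /column_of !inE /= val_Zp_nat // modn_small //.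
by case: nth.
Qed.

Lemma card_encode (P : pred (seq column)) :
  #|[set D : {set prism_vertex n} | P (encode D)]| = count P (words n).
Proof.
rewrite -size_filter cardE -(size_map (@encode n)).
apply/perm_size/uniq_perm.
- by rewrite map_inj_uniq ?enum_uniq //; exact: encode_inj.
- exact/filter_uniq/words_uniq.
move=> w; rewrite mem_filter mem_words; apply/mapP/andP => [[D]|[Pw /eqP szw]].
  by rewrite mem_enum inE => PD ->; rewrite size_encode.
by have [D eDw] := encode_surj szw; exists D; rewrite ?mem_enum ?inE eDw.
Qed.

Lemma card_weight (D : {set prism_vertex n}) :
  #|D| = sumn (map weight (encode D)).
Proof.
transitivity (\sum_(b : bool) \sum_(i : 'Z_n) ((b, i) \in D : nat)).
  rewrite pair_bigA -sum1_card big_mkcond.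
  by apply: eq_bigr => -[b i] _ /=; case: (_ \in D).
rewrite big_bool -big_split /= sumnE !big_map -[X in iota 0 X](Zp_cast n_gt1).
rewrite -[X in iota 0 X]subn0 -/(index_iota 0 _) big_mkord.
apply: eq_bigr => i _.
by rewrite natr_Zp.
Qed.

(** When the walk closes up, the boundary terms of [walk_excess_weight] cancel. *)
Lemma encode_walk (D : {set prism_vertex n}) :
  exists a b w,
    [/\ encode D = [:: a, b & w],
        dominating (@prism n) D = covered_walk a b (w ++ [:: a; b])
      & dominating (@prism n) D ->
        4 * #|D| = walk_excess a b (w ++ [:: a; b]) + 2 * n].
Proof.
rewrite card_weight.
have szD := size_encode D; pose d : column := (false, false).
(* The positions [n] and [n.+1] wrap around to 0 and 1, as [n] vanishes in ['Z_n]. *)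
have nthD i : i < n.+2 ->
    nth d (encode D ++ take 2 (encode D)) i = column_of D i%:R%R.
  move=> lt_i; rewrite nth_cat szD; case: ltnP => [lt_in|le_ni].
    by rewrite nth_mkseq.
  rewrite nth_take; last by lia.
  rewrite nth_mkseq; last by lia.
  by rewrite GRing.natrB // pchar_Zp // GRing.subr0.
case eD: (encode D) szD nthD => [|a [|b w]] /=; [lia|lia|move=> szD nthD].
rewrite take0 in nthD.
have szw : size (w ++ [:: a; b]) = n by rewrite size_cat /= addn2.
have domE : dominating (@prism n) D = covered_walk a b (w ++ [:: a; b]).
  rewrite dominating_columns.
  apply/forallP/(covered_walkP d) => [covD i|covw x].
    rewrite szw => lt_in; rewrite !nthD; try lia.
    have := covD (i.+1%:R)%R.
    by rewrite -{1}GRing.natr1 GRing.addrK GRing.natr1.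
  (* The triple centred at column [x] starts at position [x - 1]. *)
  have lt_xn : (x - 1 : 'Z_n)%R < n by rewrite -[X in _ < X](Zp_cast n_gt1).
  have := covw (x - 1 : 'Z_n)%R; rewrite szw => /(_ lt_xn).
  rewrite !nthD; try lia.
  rewrite -!GRing.natr1 natr_Zp GRing.subrK //.
by exists a, b, w; split=> //; rewrite domE => /walk_excess_weight /=; lia.
Qed.

Lemma closed_walk_encode (m : nat) (D : {set prism_vertex n}) :
  closed_walk m (encode D)
  = dominating (@prism n) D && (4 * #|D| == m + 2 * n).
Proof.
have [a [b [w [-> domE cardD]]]] := encode_walk D.
rewrite /= -domE; case: (boolP (dominating _ D)) => //= /cardD ->.
by rewrite eqn_add2r.
Qed.

Lemma dominating_card_ge (D : {set prism_vertex n}) :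
  dominating (@prism n) D -> 2 * n <= 4 * #|D|.
Proof. by have [a [b [w [_ _ cardD]]]] := encode_walk D => /cardD ->; lia. Qed.

End Encoding.

Theorem theorem3p13 (n t : nat) (hn : n = 4 * t + 2) (hn10 : 10 <= n) :
  zeta (@prism n) = n * (n + 2).
Proof.
have n_gt1 : 1 < n by lia.
have card_dom m : #|[set D | dominating (@prism n) D & 4 * #|D| == m + 2 * n]|
                  = count (closed_walk m) (words n).
  rewrite -card_encode //; apply: eq_card => D.
  by rewrite !inE closed_walk_encode.
(* Here [t >= 2] since [n >= 10], so [u = 0] corresponds to [n = 10]. *)
pose u := t - 2.
have nE : n = (4 * u.+2).+2 by rewrite /u; lia.
have := card_dom 0; rewrite [in words n]nE count_closed_walks0.
have := card_dom 4; rewrite [in words n]nE count_closed_walks4.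
move=> card4 /eqP; rewrite cards_eq0 => /eqP none0.
(* Excess 0 does not occur, so [4 * #|D|] exceeds [2 * n = 8 * t + 4]. *)
have dom_ge D : dominating (@prism n) D -> 2 * t + 2 <= #|D|.
  move=> domD; have /setP/(_ D) := none0; rewrite !inE domD => /negbT ne.
  have := dominating_card_ge n_gt1 domD; lia.
have domn : domination_number (@prism n) = 2 * t + 2.
  apply/eqP; rewrite eqn_leq; apply/andP; split; last first.
    by have [D domD <-] := domination_number_ex (@prism n); apply: dom_ge.
  have /card_gt0P[D] : 0 < #|[set D | dominating (@prism n) D
                                    & 4 * #|D| == 4 + 2 * n]|.
    by rewrite card4; lia.
  rewrite inE => /andP[/domination_number_le le_D /eqP cardD].
  by apply: leq_trans le_D _; lia.
rewrite /zeta domn.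
transitivity #|[set D | dominating (@prism n) D & 4 * #|D| == 4 + 2 * n]|.
  by apply: eq_card => D; rewrite !inE; congr (_ && _); apply/eqP/eqP; lia.
(* This turns the count into a polynomial in [u], to be compared with
   [(4 * u + 10) * (4 * u + 12)]. *)
have bin2u : 2 * 'C(u, 2) = u * (u - 1).
  by rewrite -mul_bin_diag bin1 subn1.
by rewrite card4 [in RHS]nE; nia.
Qed.
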